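(* Let $\rho\in\mathrm{Isom}(\mathbb{E})$ be a parabolic isometry of three-dimensional Minkowski space without fixed points. Then $$\mathcal{T}(\langle\rho\rangle)=\mathbb{E},$$ and the CTC region of $\mathbb{E}/\langle\rho\rangle$ is the entire space.
   Context: $\mathbb{E}$ is the affine space modeled on $\mathbb{R}^{2,1}=\mathbb{R}^3$ with the form $\mathbb{B}((x,y,z),(u,v,w))=xu+yv-zw$. A vector $v$ is timelike if $\mathbb{B}(v,v)<0$. $\mathrm{Isom}(\mathbb{E})$ is the group of affine isometries $\gamma(p)=g(p)+v$, with linear part $g\in \mathrm{O}(2,1)$ and translational part $v\in\mathbb{R}^{2,1}$; only isometries preserving orientation and time-orientation (linear part in the identity component of $\mathrm{SO}(2,1)$) are considered. Such an isometry is parabolic if $g\ne \mathrm{id}$ and $\mathrm{tr}(g)=3$. Since $\rho$ has no fixed points, $\Gamma=\langle\rho\rangle$ acts freely and properly discontinuously on $\mathbb{E}$, and $\mathbb{E}/\Gamma$ is a flat Lorentz manifold. A timelike curve in $\mathbb{E}/\Gamma$ is a $C^1$ path $c:[0,1]\to \mathbb{E}/\Gamma$ all of whose tangent vectors are timelike; it is closed if $c(0)=c(1)$. The CTC region of $\mathbb{E}/\Gamma$ is the set of points lying on some closed timelike curve. $\mathcal{T}(\Gamma)$ is the set of $p\in\mathbb{E}$ whose image $[p]$ lies in the CTC region of $\mathbb{E}/\Gamma$. *)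

(* Defs.v *)
From HB Require Import structures.
From mathcomp Require Import all_boot all_order all_algebra.
From mathcomp Require Import generic_quotient.
From mathcomp Require Import all_classical all_reals all_analysis.

Set Implicit Arguments.
Unset Strict Implicit.
Unset Printing Implicit Defensive.

Import Order.TTheory GRing.Theory Num.Theory.
Import numFieldNormedType.Exports.

Local Open Scope classical_set_scope.
Local Open Scope ring_scope.

(* The affine space E is identified with its space of translations by the
   choice of an origin, so points and vectors are both columns of height 3. *)
Definition mink_form (R : realType) (u v : 'cV[R]_3) : R :=
  u 0 0 * v 0 0 + u 1 0 * v 1 0 - u 2%:R 0 * v 2%:R 0.

Definition timelike (R : realType) (v : 'cV[R]_3) : Prop := mink_form v v < 0.

Definition SO21 (R : realType) : set 'M[R]_3 :=
  [set g | (forall u v, mink_form (g *m u) (g *m v) = mink_form u v)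
           /\ \det g = 1].

Definition SO21_id (R : realType) : set 'M[R]_3 :=
  connected_component (@SO21 R) 1%:M.

Record mink_isometry (R : realType) := MinkIsometry {
  lin_part : 'M[R]_3;
  trans_part : 'cV[R]_3;
  lin_partP : SO21_id lin_part }.

Definition mink_isometry_fun (R : realType) (rho : mink_isometry R) (p : 'cV[R]_3) :
  'cV[R]_3 := lin_part rho *m p + trans_part rho.

Coercion mink_isometry_fun : mink_isometry >-> Funclass.

Definition parabolic (R : realType) (rho : mink_isometry R) : Prop :=
  lin_part rho <> 1%:M /\ \tr (lin_part rho) = 3%:R.

(* The powers of the bijection f with exponent n >= 0, and their inverses. *)
Definition cyclic_group (T : Type) (f : T -> T) : set (T -> T) :=
  [set h | exists n : nat,
     h = iter n f \/ (cancel h (iter n f) /\ cancel (iter n f) h)].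

Section Quotient.
Variables (R : realType) (G : set ('cV[R]_3 -> 'cV[R]_3)).

Definition orbit_of (p : 'cV[R]_3) : set 'cV[R]_3 :=
  [set q | exists2 h, G h & q = h p].

(* When G is a group of maps this holds iff q is in the orbit of p; stated with
   equality of orbits, it is an equivalence relation for every set G. *)
Definition same_orbit : rel 'cV[R]_3 :=
  fun p q => `[< orbit_of p = orbit_of q >].

Lemma same_orbit_refl : reflexive same_orbit.
Proof. by move=> p; apply/asboolP. Qed.

Lemma same_orbit_sym : symmetric same_orbit.
Proof. by move=> p q; apply/asboolP/asboolP. Qed.

Lemma same_orbit_trans : transitive same_orbit.
Proof. by move=> q p r /asboolP pq /asboolP qr; apply/asboolP; rewrite pq. Qed.

Definition same_orbit_equiv :=
  EquivRel same_orbit same_orbit_refl same_orbit_sym same_orbit_trans.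

Definition orbit_space := {eq_quot same_orbit_equiv}%qT.

Definition orbit_proj (p : 'cV[R]_3) : orbit_space :=
  (\pi_(orbit_space) p)%qT.

(* The charts of the flat Lorentz manifold E/G are the local inverses of the
   projection, so a path c is C^1 with timelike tangent vectors when near each
   parameter t0 it is the projection of such a path s in E.  At the end points
   0 and 1, one-sided C^1 regularity is expressed by s being C^1 on a two-sided
   neighbourhood.  Only the values of c on [0, 1] matter. *)
Definition timelike_curve (c : R -> orbit_space) : Prop :=
  forall t0 : R, 0 <= t0 <= 1 ->
  exists s : R -> 'cV[R]_3,
    \forall t \near t0,
      [/\ (0 <= t <= 1 -> c t = orbit_proj (s t)),
          derivable s t 1,
          {for t, continuous (derive1 s)} &
          timelike (derive1 s t)].

Definition closed_timelike_curve (c : R -> orbit_space) : Prop :=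
  timelike_curve c /\ c 0 = c 1.

Definition CTC_region : set orbit_space :=
  [set x | exists2 c, closed_timelike_curve c &
             exists2 t : R, 0 <= t <= 1 & c t = x].

Definition CTC_cover : set 'cV[R]_3 := [set p | CTC_region (orbit_proj p)].

End Quotient.

Arguments CTC_region {R} G.
Arguments CTC_cover {R} G.

(* Main.v *)
(** Idea: with u = g - 1 and w = rho p - p, one has u^3 = 0, hence
    rho^n p - p = n w + C(n,2) u w + C(n,3) u^2 w, and invariance of the form B
    turns its square norm into
      n^2 (B(w,w) - B(uw,uw) (n^2 - 1) / 12).
    As im u = ker u^2 for parabolic g, the absence of fixed points gives
    u^2 w <> 0; then uw is orthogonal to the null vector u^2 w without being a
    multiple of it, so B(uw,uw) > 0.  For large n the segment from p to rho^n p
    is therefore timelike, and it projects to a closed curve through [p]. *)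
Require Import Defs.
From HB Require Import structures.
From mathcomp Require Import all_boot all_order all_algebra.
From mathcomp Require Import generic_quotient ring lra zify.
From mathcomp Require Import all_classical all_reals all_analysis.

Import Order.TTheory GRing.Theory Num.Theory.
Import numFieldNormedType.Exports.

Local Open Scope classical_set_scope.
Local Open Scope ring_scope.

(** * Linear isometries [g] of the form and the nilpotent matrix u = g - 1 *)

Lemma ord3_ind (P : 'I_3 -> Prop) : P 0 -> P 1 -> P 2%:R -> forall i, P i.
Proof.
move=> P0 P1 P2 [[|[|[|//]]] lti].
- by rewrite (_ : Ordinal lti = 0) //; apply/val_inj.
- by rewrite (_ : Ordinal lti = 1) //; apply/val_inj.
- by rewrite (_ : Ordinal lti = 2%:R) //; apply/val_inj.
Qed.

Definition mink_gram (R : realType) : 'M[R]_3 :=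
  \matrix_(i, j) ((i == j)%:R * (-1) ^+ (i == 2%:R)).

Lemma mink_formE {R : realType} (u v : 'cV[R]_3) :
  mink_form u v = (u^T *m mink_gram R *m v) 0 0.
Proof.
rewrite /mink_form /mink_gram !(mxE, big_ord_recl, big_ord0) /=.
have -> : lift ord0 (lift ord0 ord0) = 2%:R :> 'I_3 by apply/val_inj.
have -> : lift ord0 ord0 = 1 :> 'I_3 by apply/val_inj.
rewrite -[ord0]/(0 : 'I_3) /=; ring.
Qed.

(** Invariance on the basis vectors e_i, e_j is the (i, j) entry of this matrix identity. *)
Lemma SO21_gram {R : realType} {g : 'M[R]_3} :
  SO21 g -> g^T *m mink_gram R *m g = mink_gram R.
Proof.
case=> gB _; apply/matrixP => i j.
have delta_gram A : (delta_mx i 0)^T *m A *m delta_mx j (0 : 'I_1) = (A i j)%:M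
    :> 'M[R]_1.
  by rewrite trmx_delta -rowE -colE; apply/matrixP => a b; rewrite !ord1 !mxE.
have := gB (delta_mx i 0) (delta_mx j 0).
rewrite !mink_formE trmx_mul !mulmxA -(mulmxA _ (g^T)) -(mulmxA _ (_ *m _) g).
by rewrite !delta_gram !mxE.
Qed.

Lemma SO21_eigenvalue1 {R : realType} {g : 'M[R]_3} :
  SO21 g -> \det (g - 1%:M) = 0.
Proof.
move=> gSO; have [_ dg] := gSO.
set J := mink_gram R; have gJ := SO21_gram gSO.
have J0 : \det J != 0.
  rewrite det_trig; last first.
    by apply/is_trig_mxP => i j ij; rewrite mxE -val_eqE (ltn_eqF ij) mul0r.
  apply/prodf_neq0 => i _; rewrite mxE eqxx mul1r.
  by rewrite signr_eq0.
(* The dimension is odd, so that this identity makes det (g - 1) its own opposite. *)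
have : g^T *m J *m (g - 1%:M) = - ((g - 1%:M)^T *m J).
  by rewrite mulmxBr mulmx1 gJ linearB /= trmx1 mulmxBl mul1mx opprB.
move/(congr1 determinant); rewrite -[- (_ *m _)]scaleN1r detZ !det_mulmx !det_tr dg.
move=> E; apply/eqP; rewrite -(mulrI_eq0 _ (mulfI J0)); apply/eqP; lra.
Qed.

(** Determinant and trace fix two coefficients of the characteristic polynomial, and the root 1
    forces the remaining one. It is therefore (X - 1)^3, and Cayley-Hamilton applies. *)
Lemma parabolic_nilpotent {R : realType} {g : 'M[R]_3} :
  SO21 g -> \tr g = 3%:R -> (g - 1%:M) *m ((g - 1%:M) *m (g - 1%:M)) = 0.
Proof.
move=> gSO tg; have [_ dg] := gSO.
have p0 : (char_poly g)`_0 = -1 by rewrite char_poly_det dg; ring.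
have p2 : (char_poly g)`_2 = - 3%:R by rewrite (char_poly_trace g) ?tg.
have p3 : (char_poly g)`_3 = 1.
  by have /monicP := char_poly_monic g; rewrite lead_coefE size_char_poly.
have p1 : (char_poly g)`_1 = 3%:R.
  have : root (char_poly g) 1.
    rewrite -eigenvalue_root_char; apply/eigenvalueP.
    have /eqP/det0P [v v0 vg] := SO21_eigenvalue1 gSO.
    exists v => //; apply/eqP; rewrite scale1r -subr_eq0 -[X in _ - X]mulmx1.
    by rewrite -mulmxBr vg.
  rewrite rootE horner_coef size_char_poly !big_ord_recl big_ord0 /= !expr1n.
  by rewrite /bump /= p0 p2 p3 => /eqP; lra.
have -> : (g - 1%:M) *m ((g - 1%:M) *m (g - 1%:M)) = (g - 1) ^+ 3.
  by rewrite !exprS expr0 mulr1.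
rewrite -(Cayley_Hamilton g).
have -> : char_poly g = ('X - 1%:P) ^+ 3.
  have -> : char_poly g = 'X^3 - 3%:R *: 'X^2 + 3%:R *: 'X - 1%:P.
    have p4 i : (char_poly g)`_i.+4 = 0 by rewrite nth_default ?size_char_poly.
    apply/polyP => -[|[|[|[|i]]]]; rewrite ?(p0, p1, p2, p3, p4) !coefE /=; ring.
  by rewrite -!mul_polyC !rmorph_nat; ring.
by rewrite rmorphXn rmorphB /= horner_mx_X horner_mx_C.
Qed.

(* Explicitly u = [[0,a,b],[-a,0,c],[b,c,0]], and u^2 has diagonal
   (b^2 - a^2, c^2 - a^2, b^2 + c^2). *)
Lemma mink_skew_sq0 {R : realType} (u : 'M[R]_3) :
  u^T *m mink_gram R = - (mink_gram R *m u) -> u *m u = 0 -> u = 0.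
Proof.
have o1 : lift ord0 ord0 = 1 :> 'I_3 by apply/val_inj.
have o2 : lift ord0 (lift ord0 ord0) = 2%:R :> 'I_3 by apply/val_inj.
move=> uJ uu.
have skew i j : (u^T *m mink_gram R) i j = (- (mink_gram R *m u)) i j by rewrite uJ.
have sq i : (u *m u) i i = 0 by rewrite uu mxE.
have := (skew 0 0, skew 1 1, skew 2%:R 2%:R, skew 0 1, skew 0 2%:R, skew 1 2%:R,
         sq 0, sq 1, sq 2%:R).
rewrite !(mxE, big_ord_recl, big_ord0) /= !o1 !o2 /= -[ord0]/(0 : 'I_3).
rewrite !(expr0, expr1, mul0r, mulr0, add0r, addr0, mul1r, mulr1).
case=> -[] -[] -[] -[] -[] -[] -[].
move=> s00 s11 s22 s01 s02 s12 q0 q1 q2.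
have e00 : u 0 0 = 0 by lra.
have e11 : u 1 1 = 0 by lra.
have e22 : u 2%:R 2%:R = 0 by lra.
have e10 : u 1 0 = - u 0 1 by lra.
have e20 : u 2%:R 0 = u 0 2%:R by lra.
have e21 : u 2%:R 1 = u 1 2%:R by lra.
have e02 : u 0 2%:R = 0.
  by apply/eqP; rewrite -sqrf_eq0; apply/eqP; move: q2; rewrite e20 e21 e22; nra.
have e12 : u 1 2%:R = 0.
  by apply/eqP; rewrite -sqrf_eq0; apply/eqP; move: q2; rewrite e20 e21 e22; nra.
have e01 : u 0 1 = 0.
  apply/eqP; rewrite -sqrf_eq0; apply/eqP; move: q0.
  by rewrite e00 e10 e02; nra.
apply/matrixP => i j; rewrite [RHS]mxE.
elim/ord3_ind: i; elim/ord3_ind: j;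
  by rewrite ?(e00, e11, e22, e10, e20, e21, e02, e12, e01) ?oppr0.
Qed.

(** * Kernels of nilpotent matrices and complements of null vectors *)

(** A nilpotent u with u^2 nonzero is a single Jordan block, so im u = ker u^2 by dimension.
    Transposing to [A] turns columns into the row spaces of [mxalgebra]. *)
Lemma nilpotent3_ker_sq {F : fieldType} (u : 'M[F]_3) (w : 'cV[F]_3) :
  u *m (u *m u) = 0 -> u *m u != 0 -> u *m (u *m w) = 0 ->
  exists q, w = u *m q.
Proof.
move=> u3 u2 uuw; pose A := u^T.
have A3 : A *m (A *m A) = 0 by rewrite -!trmx_mul -mulmxA u3 trmx0.
have A2 : A *m A != 0 by rewrite -trmx_mul trmx_eq0.
have sAK : (A <= kermx (A *m A))%MS by apply/sub_kermxP.
have wK : (w^T <= kermx (A *m A))%MS.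
  by apply/sub_kermxP; rewrite -!trmx_mul -mulmxA uuw trmx0.
have rK := mxrank_leqif_sup sAK; rewrite mxrank_ker in rK.
have r2 : (0 < \rank (A *m A))%N by rewrite lt0n mxrank_eq0.
(* Frobenius gives 2 rank A^2 <= rank A, while A^3 = 0 gives rank A + rank A^2 <= 3; the ranks are
   thus 2 and 1. *)
have := mxrank_Frobenius A A A; rewrite -(mulmxA A) A3 mxrank0 => rF.
have rS := mulmx0_rank_max A3.
have KA : (kermx (A *m A) <= A)%MS by rewrite -rK; apply/eqP; lia.
have /submxP [D wD] := submx_trans wK KA.
by exists D^T; rewrite -[w]trmxK wD trmx_mul trmxK.
Qed.

(** On the orthogonal complement of a null vector [v] the form is positive semidefinite, and its
    radical is the line of [v]. *)
Lemma null_orthogonal_spacelike {R : realType} (x v : 'cV[R]_3) :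
  mink_form x v = 0 -> mink_form v v = 0 -> v != 0 ->
  (forall k, x <> k *: v) -> 0 < mink_form x x.
Proof.
have cV3P (a b : 'cV[R]_3) :
    a 0 0 = b 0 0 -> a 1 0 = b 1 0 -> a 2%:R 0 = b 2%:R 0 -> a = b.
  by move=> e0 e1 e2; apply/matrixP => i j; rewrite !ord1; elim/ord3_ind: i.
rewrite /mink_form => xv vv v0 xkv.
(* A null vector with vanishing time coordinate is zero. *)
have r0 : v 2%:R 0 != 0.
  apply: contraNneq v0 => r0; rewrite r0 in vv; apply/eqP.
  apply: cV3P; rewrite ?r0 !mxE //; apply/eqP; rewrite -sqrf_eq0; apply/eqP; nra.
move: xv vv xkv r0.
set x0 := x 0 0; set x1 := x 1 0; set x2 := x 2%:R 0.
set v0' := v 0 0; set v1 := v 1 0; set r := v 2%:R 0 => xv vv xkv r0.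
have r2 : 0 < r ^+ 2 by rewrite lt0r sqrf_eq0 r0 sqr_ge0.
rewrite -(pmulr_lgt0 _ r2).
(* Lagrange's identity, given that v is null and orthogonal to x *)
have -> : (x0 * x0 + x1 * x1 - x2 * x2) * r ^+ 2 = (x0 * v1 - x1 * v0') ^+ 2.
  have -> : r ^+ 2 = v0' * v0' + v1 * v1 by lra.
  have xr : x2 * r = x0 * v0' + x1 * v1 by lra.
  rewrite mulrBl; have -> : x2 * x2 * (v0' * v0' + v1 * v1) = (x2 * r) ^+ 2.
    by rewrite exprMn expr2; congr (_ * _); lra.
  by rewrite xr; ring.
rewrite lt0r sqr_ge0 sqrf_eq0 andbT; apply/eqP => D0.
(* The factor is read off from the time coordinates. *)
apply: (xkv (x2 / r)); apply: cV3P; rewrite !mxE -/x0 -/x1 -/x2 -/v0' -/v1 -/r.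
- apply: (mulIf (lt0r_neq0 r2)); rewrite [RHS](_ : _ = x2 * r * v0'); last by field.
  have -> : r ^+ 2 = v0' * v0' + v1 * v1 by lra.
  have -> : x2 * r = x0 * v0' + x1 * v1 by lra.
  have -> : x0 * (v0' * v0' + v1 * v1) = (x0 * v0' + x1 * v1) * v0' +
    (x0 * v1 - x1 * v0') * v1 by ring.
  by rewrite D0 mul0r addr0.
- apply: (mulIf (lt0r_neq0 r2)); rewrite [RHS](_ : _ = x2 * r * v1); last by field.
  have -> : r ^+ 2 = v0' * v0' + v1 * v1 by lra.
  have -> : x2 * r = x0 * v0' + x1 * v1 by lra.
  have -> : x1 * (v0' * v0' + v1 * v1) = (x0 * v0' + x1 * v1) * v1 -
    (x0 * v1 - x1 * v0') * v0' by ring.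
  by rewrite D0 mul0r subr0.
- by field.
Qed.

(** * The form along the chain w, u w, u^2 w *)

Lemma mink_form_comb3 {R : realType} (a b c : R) (x y z : 'cV[R]_3) :
  let s := a *: x + b *: y + c *: z in
  mink_form s s =
    a ^+ 2 * mink_form x x + b ^+ 2 * mink_form y y + c ^+ 2 * mink_form z z +
    2%:R * (a * b * mink_form x y + a * c * mink_form x z + b * c * mink_form y z).
Proof. by rewrite /mink_form !mxE; ring. Qed.

(** This is B(gx, gy) = B(x, y) expanded with g = 1 + u. *)
Lemma mink_form_shift {R : realType} {g : 'M[R]_3} (x y : 'cV[R]_3) :
  SO21 g -> let u := g - 1%:M in
  mink_form (u *m x) y + mink_form x (u *m y) + mink_form (u *m x) (u *m y) = 0.
Proof.
case=> gB _ u; have := gB x y.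
have gE z : g *m z = z + u *m z by rewrite mulmxBl mul1mx addrC subrK.
rewrite !gE /mink_form !mxE; lra.
Qed.

(** Invariance reads u^T J + J u + u^T J u = 0. If u^2 = 0, multiplying by u on the right leaves u^T
    J u = 0, so u is skew for J and [mink_skew_sq0] gives u = 0. *)
Lemma parabolic_sq_neq0 {R : realType} {g : 'M[R]_3} :
  SO21 g -> g != 1%:M -> (g - 1%:M) *m (g - 1%:M) != 0.
Proof.
move=> gSO g1; apply: contraNneq g1 => u2; set u := g - 1%:M in u2 *.
rewrite -subr_eq0 -/u; apply/eqP/mink_skew_sq0 => //.
have gE : g = 1%:M + u by rewrite addrC subrK.
clearbody u.
have := SO21_gram gSO.
rewrite {1 2}gE [_^T]linearD /= trmx1 !(mulmxDl, mulmxDr, mul1mx, mulmx1).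
set J := mink_gram R; set uJ := u^T *m J => e.
have e1 : uJ + J *m u + uJ *m u = 0.
  by apply: (addrI J); rewrite addr0 -[RHS]e !addrA.
have uJu : uJ *m u = 0.
  move/(congr1 (mulmx^~ u)): e1.
  by rewrite !mulmxDl -!mulmxA u2 !mulmx0 !addr0 mul0mx mulmxA.
by apply/eqP; rewrite -addr_eq0 -e1 uJu addr0.
Qed.

Lemma mink_formC {R : realType} (x y : 'cV[R]_3) : mink_form x y = mink_form y x.
Proof. by rewrite /mink_form; ring. Qed.

Lemma mink_form0r {R : realType} (x : 'cV[R]_3) : mink_form x 0 = 0.
Proof. by rewrite /mink_form !mxE; ring. Qed.

(** [mink_form_shift] at (w, w2), (w1, w1), (w, w1) and (w, w) gives linear relations that determine
    these products successively. *)
Lemma parabolic_jordan_forms {R : realType} {g : 'M[R]_3} (w : 'cV[R]_3) :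
  SO21 g -> \tr g = 3%:R ->
  let u := g - 1%:M in
  let w1 := u *m w in
  let w2 := u *m w1 in
  [/\ u *m w2 = 0, mink_form w2 w2 = 0, mink_form w1 w2 = 0,
      mink_form w w2 = - mink_form w1 w1 &
      mink_form w w1 = - mink_form w1 w1 / 2%:R].
Proof.
move=> gSO tg u w1 w2.
have u3 : u *m w2 = 0.
  have /(congr1 (mulmx^~ w)) := parabolic_nilpotent gSO tg.
  by rewrite mul0mx -!mulmxA.
have := mink_form_shift w w gSO; have := mink_form_shift w w1 gSO.
have := mink_form_shift w w2 gSO; have := mink_form_shift w1 w1 gSO.
rewrite /= -/u -/w1 -/w2 u3 !mink_form0r (mink_formC w2 w1) (mink_formC w1 w).
by split => //; lra.
Qed.

(** The coefficients are the binomials C(m, k) as polynomials in m. In degree 4, B(uw, uw) receives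
    1/4 from its own square and -1/3 from the cross term of w and u^2 w, hence the decisive
    -1/12. *)
Lemma parabolic_displacement_form {R : realType} {g : 'M[R]_3} (w : 'cV[R]_3)
    (m : R) :
  SO21 g -> \tr g = 3%:R ->
  let u := g - 1%:M in
  let s := m *: w + (m * (m - 1) / 2%:R) *: (u *m w)
           + (m * (m - 1) * (m - 2%:R) / 6%:R) *: (u *m (u *m w)) in
  mink_form s s = m ^+ 2 *
    (mink_form w w - mink_form (u *m w) (u *m w) * (m ^+ 2 - 1) / 12%:R).
Proof.
move=> gSO tg u s; rewrite mink_form_comb3.
have [_ -> -> -> ->] := parabolic_jordan_forms w gSO tg.
by field.
Qed.

Lemma parabolic_spacelike {R : realType} {g : 'M[R]_3} (w : 'cV[R]_3) :
  SO21 g -> g != 1%:M -> \tr g = 3%:R ->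
  let u := g - 1%:M in
  (forall q, w <> u *m q) -> 0 < mink_form (u *m w) (u *m w).
Proof.
move=> gSO g1 tg u wNim.
have [u3 B22 B12 _ _] := parabolic_jordan_forms w gSO tg.
have w20 : u *m (u *m w) != 0.
  apply/eqP => w20.
  have [|q /wNim //] := nilpotent3_ker_sq _ _ (parabolic_nilpotent gSO tg) _ w20.
  exact: parabolic_sq_neq0.
apply: (null_orthogonal_spacelike _ _ B12 B22 w20) => k w1E.
(* Applying u to u w = k u^2 w yields u^2 w = k u^3 w = 0. *)
by move/eqP: w20; rewrite w1E -scalemxAr u3 scaler0.
Qed.

(** * Displacement of the iterates *)

(** The displacement is the sum of (1 + u)^k w over k < n, truncated by u^3 = 0. *)
Lemma iter_displacement {R : realType} {rho : mink_isometry R} (p : 'cV[R]_3) n :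
  SO21 (lin_part rho) -> \tr (lin_part rho) = 3%:R ->
  let u := lin_part rho - 1%:M in
  let w := rho p - p in
  let m := n%:R in
  iter n rho p - p = m *: w + (m * (m - 1) / 2%:R) *: (u *m w)
           + (m * (m - 1) * (m - 2%:R) / 6%:R) *: (u *m (u *m w)).
Proof.
move=> gSO tg u w; have [u3 _ _ _ _] := parabolic_jordan_forms w gSO tg.
elim: n => [|n IH] /=; first by rewrite subrr !mul0r !scale0r !addr0.
have rhoD x y : rho (x + y) = rho x + (y + u *m y).
  rewrite /mink_isometry_fun mulmxDr addrAC; congr (_ + _).
  by rewrite mulmxBl mul1mx addrC subrK.
rewrite -[iter n rho p](subrKC p) rhoD IH addrAC -/w.
rewrite -/u in u3; clearbody w.
rewrite !mulmxDr -!scalemxAr u3 scaler0 addr0.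
set w1 := u *m w; set w2 := u *m w1.
(* The coefficients match by Pascal's rule. *)
apply/matrixP => i j; rewrite !mxE -natr1; by field.
Qed.

Lemma iter_timelike {R : realType} {rho : mink_isometry R} (p : 'cV[R]_3) :
  SO21 (lin_part rho) -> parabolic rho -> (forall q : 'cV[R]_3, rho q <> q) ->
  exists n, timelike (iter n rho p - p).
Proof.
move=> gSO [/eqP g1 tg] nofix.
set u := lin_part rho - 1%:M; set w := rho p - p.
have c0 : 0 < mink_form (u *m w) (u *m w).
  (* If w = u q, then p - q is fixed: its displacement is w - u q. *)
  apply: parabolic_spacelike => // q wq; apply: (nofix (p - q)).
  apply/eqP; rewrite -subr_eq0; apply/eqP.
  rewrite -[RHS](subrr w) [X in _ = _ - X]wq.
  rewrite /w /u /mink_isometry_fun mulmxBr mulmxBl mul1mx.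
  by apply/matrixP => i j; rewrite !mxE; ring.
set c := mink_form _ _ in c0; set a := mink_form w w.
(* This makes c n > 12 |a|; also n >= 2, so that n^2 - 1 >= n and the term in n^2 - 1 dominates. *)
pose n := (Num.truncn (12%:R * `|a| / c)).+2.
have an : 12%:R * `|a| < c * n%:R.
  rewrite [ltRHS]mulrC -ltr_pdivrMr // /n.
  by apply: (lt_trans (truncnS_gt _)); rewrite ltr_nat.
exists n; rewrite /timelike iter_displacement // parabolic_displacement_form //.
rewrite -/u -/w -/c -/a.
have n2 : 2%:R <= n%:R :> R by rewrite ler_nat.
rewrite pmulr_rlt0; last by rewrite exprn_gt0 //; lra.
have cm : 0 <= c * (n%:R ^+ 2 - 1 - n%:R) by rewrite mulr_ge0 ?(ltW c0) //; nra.
by have := ler_norm a; lra.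
Qed.

(** * Orbits of the cyclic group *)

Lemma SO21_id_sub {R : realType} (g : 'M[R]_3) : SO21_id g -> SO21 g.
Proof. exact: connected_component_sub. Qed.

Lemma mink_isometry_bij {R : realType} (rho : mink_isometry R) : bijective rho.
Proof.
have [_ dg] := SO21_id_sub _ (lin_partP rho).
have gU : lin_part rho \in unitmx by rewrite unitmxE dg unitr1.
exists (fun q => invmx (lin_part rho) *m (q - trans_part rho)) => p.
  by rewrite /mink_isometry_fun addrK mulKmx.
by rewrite /mink_isometry_fun mulKVmx // subrK.
Qed.

(** Precomposition with f or its inverse preserves the cyclic group; the case splits follow its
    encoding by natural powers and their inverses. *)
Lemma orbit_of_image {R : realType} (f : 'cV[R]_3 -> 'cV[R]_3) (p : 'cV[R]_3) :
  bijective f -> orbit_of (cyclic_group f) (f p) = orbit_of (cyclic_group f) p.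
Proof.
case=> f' fK f'K.
have cyclic_comp h : cyclic_group f h -> cyclic_group f (h \o f).
  case=> n [->|[hK Kh]].
    by exists n.+1; left; apply/funext => x; rewrite iterSr.
  case: n hK Kh => [|n] hK Kh.
    (* Here [h] inverts the zeroth power, so it is the identity and [h \o f] is f itself. *)
    by exists 1; left; apply/funext => x /=; exact: (can_inj hK (hK _)).
  exists n; right; split => x; first by apply: (can_inj fK); rewrite -iterS hK.
  rewrite /= -iterS; exact: Kh.
have cyclic_compV h : cyclic_group f h -> cyclic_group f (h \o f').
  case=> n [->|[hK Kh]].
    case: n => [|n].
      by exists 1; right; split => x /=; rewrite (f'K, fK).
    by exists n; left; apply/funext => x /=; rewrite -iterS iterSr f'K.
  exists n.+1; right; split => x /=; first by rewrite hK f'K.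
  by rewrite fK Kh.
apply/seteqP; split => _ [h hG ->].
  by exists (h \o f) => //; apply: cyclic_comp.
by exists (h \o f'); [apply: cyclic_compV|rewrite /= fK].
Qed.

Lemma orbit_proj_iter {R : realType} (f : 'cV[R]_3 -> 'cV[R]_3) (p : 'cV[R]_3) n :
  bijective f ->
  orbit_proj (cyclic_group f) (iter n f p) = orbit_proj (cyclic_group f) p.
Proof.
move=> fB; apply/eqquotP/asboolP.
by elim: n => //= n IH; rewrite orbit_of_image.
Qed.

(** * Closed timelike curves from segments *)

Lemma is_derive_line {R : realType} (V : normedModType R) (p d : V) (t : R) :
  is_derive t 1 (fun x : R => p + x *: d) d.
Proof.
have slope : (fun h : R => h^-1 *: (((fun x => p + x *: d) \o shift t) (h *: 1) -
    (p + t *: d))) @ 0^' --> d.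
  apply: cvg_near_cst; near=> h.
  have h0 : h != 0 by near: h; exact: nbhs_dnbhs_neq.
  rewrite /= -[h *: 1]/(h * 1) mulr1 opprD addrACA subrr add0r -scalerBl addrK.
  by rewrite scalerA mulVf // scale1r.
by apply: DeriveDef; [apply: cvgP slope | apply: cvg_lim slope].
Unshelve. all: end_near.
Qed.

(** The segment from [p] to [q] has constant velocity [q - p], and its projection closes up because
    its end points have the same image. *)
Lemma CTC_segment {R : realType} (G : set ('cV[R]_3 -> 'cV[R]_3)) (p q : 'cV[R]_3) :
  timelike (q - p) -> orbit_proj G q = orbit_proj G p -> CTC_cover G p.
Proof.
move=> tqp eqp; pose s t : 'cV[R]_3 := p + t *: (q - p).
have ds (t : R) : is_derive t 1 s (q - p) by exact: is_derive_line.
have s1 : derive1 s = cst (q - p).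
  by apply/funext => t; rewrite derive1E; apply: derive_val.
exists (fun t => orbit_proj G (s t)); last first.
  by exists 0; rewrite ?lexx ?ler01 // /s scale0r addr0.
split; last by rewrite /s scale0r addr0 scale1r subrKC.
(* The full line lifts the curve near every parameter, running past 0 and 1 at the end points. *)
move=> t0 _; exists s; near=> t; split=> //; rewrite ?s1 //.
exact: (@cst_continuous R^o).
Unshelve. all: end_near.
Qed.

Theorem theorem3p3 (R : realType) (rho : mink_isometry R)
  (rho_parabolic : parabolic rho)
  (rho_no_fixpoint : forall p : 'cV[R]_3, rho p <> p) :
  CTC_cover (cyclic_group rho) = [set: 'cV[R]_3] /\
  CTC_region (cyclic_group rho) = [set: orbit_space (cyclic_group rho)].
Proof.
have cover p : CTC_cover (cyclic_group rho) p.
  have [n ntl] := iter_timelike p (SO21_id_sub _ (lin_partP rho)) rho_parabolic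
    rho_no_fixpoint.
  exact: CTC_segment ntl (orbit_proj_iter _ _ _ (mink_isometry_bij rho)).
split; apply/seteqP; split=> // x _.
(* Each point of the quotient is the class of its representative. *)
by rewrite -[x]reprK; apply: cover.
Qed.
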